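(* Let $\mathcal G$ be the class of all stationary and ergodic binary finitarily Markovian processes. Then there is no classification for $\mathcal G$ in a pointwise sense, and there is no classification for $\mathcal G$ in probability.
   Context: A binary process (binary time series) is a sequence of $\{0,1\}$-valued random variables $\{X_n\}_{n=1}^\infty$. A one-sided stationary process is always regarded as extended to a two-sided stationary process $\{X_n\}_{n=-\infty}^\infty$. For $m\le n$ write $X_m^n=(X_m,\dots,X_n)$, and similarly for deterministic sequences. A stationary and ergodic binary process $\{X_n\}$ is finitarily Markovian if for almost every past $x_{-\infty}^{-1}$ (with respect to the distribution of $X_{-\infty}^{-1}$) there is a finite $K=K(x_{-\infty}^{-1})$ such that for all $i>0$ and all $y_{-i}^{-1}\in\{0,1\}^i$: if $P(X_0=1\mid X_{-K-i}^{-K-1}=y_{-i}^{-1},\,X_{-K}^{-1}=x_{-K}^{-1})>0$ (in particular, the conditioning event has positive probability), then $$P(X_0=1\mid X_{-K}^{-1}=x_{-K}^{-1})=P(X_0=1\mid X_{-K-i}^{-K-1}=y_{-i}^{-1},\,X_{-K}^{-1}=x_{-K}^{-1}).$$ Let $\mathcal G$ be a subclass of the class of all stationary and ergodic binary processes. A sequence of functions $g_n:\{0,1\}^n\to\{YES,NO\}$, $n\ge1$, is a classification for $\mathcal G$ in probability if $\lim_{n\to\infty}P(g_n(X_1,\dots,X_n)=YES)=1$ for all processes $\{X_n\}$ in $\mathcal G$, and $\lim_{n\to\infty}P(g_n(X_1,\dots,X_n)=NO)=1$ for all stationary and ergodic binary processes $\{X_n\}$ not in $\mathcal G$. It is a classification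 for $\mathcal G$ in a pointwise sense if, almost surely, $g_n(X_1,\dots,X_n)=YES$ for all sufficiently large $n$, for all processes $\{X_n\}$ in $\mathcal G$; and, almost surely, $g_n(X_1,\dots,X_n)=NO$ for all sufficiently large $n$, for all stationary and ergodic binary processes $\{X_n\}$ not in $\mathcal G$. *)

(* Defs.v *)
From HB Require Import structures.
From mathcomp Require Export all_boot all_order all_algebra.
From mathcomp Require Export all_classical all_reals all_analysis.
Export numFieldNormedType.Exports.
Export Order.TTheory GRing.Theory Num.Theory.

Set Implicit Arguments.
Unset Strict Implicit.
Unset Printing Implicit Defensive.

Local Open Scope classical_set_scope.
Local Open Scope ring_scope.

(* One-sided stationary processes are always identified with their two-sided
   extensions, so processes are indexed by int from the start. *)
Record process (R : realType) := Process {
  proc_display : measure_display;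
  proc_space : measurableType proc_display;
  proc_prob : probability proc_space R;
  proc_var : int -> {RV proc_prob >-> bool} }.

(* Doubly infinite binary sequences. *)
Definition biseq : Type := int -> bool.

Definition sample_path (R : realType) (X : process R) (t : proc_space X) :
  biseq := fun n => proc_var X n t.

(* The word (x_m, ..., x_{m+n-1}). *)
Definition block (x : biseq) (m : int) (n : nat) : n.-tuple bool :=
  [tuple x (m + i%:Z) | i < n].

Definition biseq_measurable : set (set biseq) :=
  <<s [set A | exists (n : int) (b : bool), A = [set x | x n = b]] >>.

Definition biseq_shift (x : biseq) : biseq := fun n => x (n + 1).

(* Invariance of all finite-dimensional distributions; over a finite alphabet
   these are given by the probabilities of words. *)
Definition stationary (R : realType) (X : process R) : Prop :=
  forall (m : int) (n : nat) (w : n.-tuple bool),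
    proc_prob X [set t | block (sample_path (X := X) t) (m + 1) n = w] =
    proc_prob X [set t | block (sample_path (X := X) t) m n = w].

Definition ergodic (R : realType) (X : process R) : Prop :=
  forall A : set biseq, biseq_measurable A -> biseq_shift @^-1` A = A ->
    proc_prob X (@sample_path R X @^-1` A) = 0%E \/
    proc_prob X (@sample_path R X @^-1` A) = 1%E.

(* P(A | B), with value 0 when P(B) = 0 because x / 0 = 0; in particular
   0 < cond_prob P A B forces P(B) > 0. *)
Definition cond_prob (R : realType) (d : measure_display)
    (T : measurableType d) (P : probability T R) (A B : set T) : R :=
  fine (P (A `&` B)) / fine (P B).

(* K is a memory length for the past x_{-oo}^{-1}; only the coordinates of x
   with negative index are used. *)
Definition memory_length (R : realType) (X : process R) (x : biseq) (K : nat) :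
  Prop :=
  let one := [set t : proc_space X | proc_var X 0 t = true] in
  let recent := [set t : proc_space X |
    block (sample_path t) (- K%:Z) K = block x (- K%:Z) K] in
  forall (i : nat) (y : i.-tuple bool), (0 < i)%N ->
    let remote := [set t : proc_space X |
      block (sample_path t) (- (K + i)%N%:Z) i = y] in
    0 < cond_prob (proc_prob X) one (remote `&` recent) ->
    cond_prob (proc_prob X) one recent =
    cond_prob (proc_prob X) one (remote `&` recent).

Definition finitarily_markovian (R : realType) (X : process R) : Prop :=
  {ae proc_prob X, forall t, exists K : nat,
    memory_length X (sample_path t) K}.

Inductive answer := YES | NO.

(* The value at n = 0 plays no role in the limits below. *)
Definition classifier := forall n : nat, n.-tuple bool -> answer.

(* g_n(X_1, ..., X_n) as a function on the probability space. *)
Definition verdict (R : realType) (g : classifier) (X : process R) (n : nat)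
  (t : proc_space X) : answer := g n (block (sample_path t) 1 n).

Definition classification_in_probability (R : realType)
    (G : process R -> Prop) (g : classifier) : Prop :=
  (forall X : process R, G X ->
     proc_prob X [set t | verdict g n t = YES] @[n --> \oo] --> 1%E) /\
  (forall X : process R, stationary X -> ergodic X -> ~ G X ->
     proc_prob X [set t | verdict g n t = NO] @[n --> \oo] --> 1%E).

Definition classification_pointwise (R : realType)
    (G : process R -> Prop) (g : classifier) : Prop :=
  (forall X : process R, G X ->
     {ae proc_prob X, forall t, \forall n \near \oo, verdict g n t = YES}) /\
  (forall X : process R, stationary X -> ergodic X -> ~ G X ->
     {ae proc_prob X, forall t, \forall n \near \oo, verdict g n t = NO}).

Definition finitarily_markovian_class (R : realType) (X : process R) : Prop :=
  [/\ stationary X, ergodic X & finitarily_markovian X].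

(* Main.v *)
From HB Require Import structures.
Require Import Defs.
From mathcomp Require Import measurable_realfun.
From mathcomp Require Import zify ring lra.

(** By continuity from below, a pointwise classification is a classification
in probability, so it suffices to refute a classification g in probability.
This is done by producing one stationary ergodic process that is not
finitarily Markovian but to which g answers YES with probability at least
1/2 at arbitrarily late times.

All processes live on the dyadic integers with Haar measure and have the form
X_n(s) = 1 if s + n lies in A and 0 otherwise, for a measurable set A. Adding
1 preserves Haar measure, so these processes are stationary. They are ergodic
because a set invariant under adding 1 meets every residue class modulo 2^k in
the same proportion; hence it is independent of all cylinders, then of every
measurable set, in particular of itself ([adic_ergodic]).

If A is a union of residue classes modulo 2^e, the process is periodic, hence
finitarily Markovian, and g eventually says YES to it with probability close
to 1. Starting from the empty set, enlarge A step by step. At stage k, A is a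
union of classes modulo q = 2^(e k); choose a time N k >= k at which g says
YES with probability at least 3/4, then add to A exactly q residue classes
(the marks) modulo a much larger 2^(e (k+1)). Let reach k be at least q and at
least N k. The probabilities that a mark of stage i is met within distance
reach i of time 0, summed over i >= k, amount to very little, so the limit
process still receives the answer YES at time N k with probability at least
3/4 - 1/4 ([verdict_limit_ge]).

The marks are placed so that every phase modulo q contains one, and so that
they are more than q apart. Take a typical point s: one having, for every k, no
mark of stage k within reach k of time 0. Such points have probability at least
3/4. For each k let p_k be the conditional probability of X_0 = 1 given the
last q symbols of s.
- p_k > 0: most points at the mark of stage k in the phase of s have the same
  last q symbols as s, and X_0 = 1 there ([typical_cond_prob_gt0]).
- p_k <= 2^(-k): after these symbols X_0 = 1 contradicts q-periodicity unless a
  mark of stage k or later is close, and the sum of the probabilities of this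
  is small even relative to 1/q, which is up to a constant a lower bound for
  the probability of the conditioning event ([typical_cond_prob_le]).
A memory length K for s would make p_k the same positive number for all k with
K < 2^(e k), contradicting p_k <= 2^(-k) ([typical_no_memory_length]). *)

Set Implicit Arguments.
Unset Strict Implicit.
Unset Printing Implicit Defensive.

Local Open Scope classical_set_scope.
Local Open Scope ring_scope.

(** * The dyadic adding machine *)

(** Dyadic integers, least significant binary digit first. *)
Definition digits : Type := nat -> bool.

Fixpoint residue (k : nat) (s : digits) : int :=
  if k is l.+1 then residue l s + (s l)%:Z * 2 ^+ l else 0.

(** Addition of the ordinary integer n. The digit of index k of the sum is read
off the sum modulo 2 ^ (k + 1); this avoids carries and treats negative n
uniformly. *)
Definition translate (n : int) (s : digits) : digits :=
  fun k => 2 ^+ k <= ((residue k.+1 s + n) %% 2 ^+ k.+1)%Z.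

Lemma pow2_gt0 (k : nat) : 0 < 2 ^+ k :> int.
Proof. by rewrite exprn_gt0. Qed.

Lemma residue_bounds (k : nat) (s : digits) : 0 <= residue k s < 2 ^+ k.
Proof.
elim: k => [|k IH] //=; rewrite exprS; have := pow2_gt0 k.
by case: (s k); lia.
Qed.

Lemma residue_mod (k l : nat) (s : digits) : (k <= l)%N ->
  (residue l s %% 2 ^+ k)%Z = residue k s.
Proof.
elim: l => [|l IH]; first by rewrite leqn0 => /eqP ->; rewrite modz_small.
rewrite leq_eqVlt => /predU1P[->|].
  by rewrite modz_small// residue_bounds.
rewrite ltnS => kl; rewrite /= -(subnK kl) exprD mulrA addrC modzMDl.
by rewrite subnK// IH.
Qed.

Lemma modz_pow2 (k l : nat) (x : int) : (k <= l)%N ->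
  ((x %% 2 ^+ l)%Z = x %[mod 2 ^+ k])%Z.
Proof.
move=> kl; rewrite [in RHS](divz_eq x (2 ^+ l)).
by rewrite -[in X in (_ * X + _)%R](subnK kl) exprD mulrA modzMDl.
Qed.

Lemma residue_translate (k : nat) (n : int) (s : digits) :
  residue k (translate n s) = ((residue k s + n) %% 2 ^+ k)%Z.
Proof.
elim: k => [|k IH]; first by rewrite modz1.
rewrite [LHS]/= IH {1}/translate.
set y := (((residue k.+1 s + n) %% 2 ^+ k.+1)%Z).
have -> : ((residue k s + n) %% 2 ^+ k)%Z = (y %% 2 ^+ k)%Z.
  by rewrite -(residue_mod s (leqnSn k)) modzDml modz_pow2.
have := pow2_gt0 k; have : 0 <= y < 2 ^+ k.+1.
  by rewrite modz_ge0 ?ltz_pmod ?pow2_gt0 ?gt_eqF ?pow2_gt0.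
rewrite exprS; move: (2 ^+ k) y => p y yp p0.
case: leP => py /=; last by rewrite mul0r addr0 modz_small//; lia.
rewrite mul1r {1}(_ : y = 1 * p + (y - p)); last by lia.
by rewrite modzMDl modz_small; lia.
Qed.

Lemma residue_inj (s s' : digits) :
  (forall k, residue k s = residue k s') -> s = s'.
Proof.
move=> ss'; apply/funext => k; have := ss' k.+1; rewrite /= ss'.
move/addrI/mulIf; rewrite gt_eqF ?pow2_gt0// => /(_ isT).
by case: (s k) (s' k) => -[].
Qed.

Lemma translateD (m n : int) (s : digits) :
  translate m (translate n s) = translate (n + m) s.
Proof.
by apply: residue_inj => k; rewrite !residue_translate modzDml addrA.
Qed.

Lemma translate0 (s : digits) : translate 0 s = s.
Proof.
apply: residue_inj => k.
by rewrite residue_translate addr0 modz_small ?residue_bounds.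
Qed.

(** * Haar measure on the dyadic integers *)

(** The empty set is included to make the family stable under intersection: two
residue classes modulo powers of 2 are nested or disjoint. *)
Definition cylinders : set (set digits) :=
  [set A | A = set0 \/ exists k v, A = [set s | residue k s = v]].

Notation adic := (g_sigma_algebraType cylinders).

Lemma cylinders_setI : setI_closed cylinders.
Proof.
suff nested k l v w : (k <= l)%N ->
    cylinders ([set s | residue k s = v] `&` [set s | residue l s = w]).
  move=> A B [->|[k [v ->]]] => [_|[->|[l [w ->]]]].
  - by left; rewrite set0I.
  - by left; rewrite setI0.
  - by have [/nested|/ltnW/nested] := leqP k l; rewrite // setIC.
move=> kl; have [wv|wv] := eqVneq (w %% 2 ^+ k)%Z v.
  right; exists l, w; apply/seteqP; split=> s /=; first by case.
  by move=> sw; split=> //; rewrite -(residue_mod s kl) sw.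
left; apply/seteqP; split=> s //= [sv sw].
by move/eqP: wv; rewrite -sw residue_mod.
Qed.

Lemma measurable_cylinder (k : nat) (v : int) :
  measurable ([set s | residue k s = v] : set adic).
Proof. by apply: sub_sigma_algebra; right; exists k, v. Qed.

Lemma measurable_residue (k : nat) (C : set int) :
  measurable ([set s | C (residue k s)] : set adic).
Proof.
rewrite (_ : [set s | _] = \bigcup_(n in [set n | C n%:Z])
    ([set s | residue k s = n%:Z] : set adic)).
  by apply: bigcup_measurable => n _; exact: measurable_cylinder.
apply/seteqP; split=> [s /= Cs|s [n /= Cn ->]//].
have /andP[s0 _] := residue_bounds k s.
by exists `|residue k s|%N => /=; rewrite gez0_abs.
Qed.

Lemma measurable_fun_adic d (T : measurableType d) (F : T -> adic) :
  (forall k v, measurable [set t | residue k (F t) = v]) ->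
  measurable_fun setT F.
Proof.
move=> mF; apply: (@measurability _ _ T adic setT F cylinders) => //.
move=> _ [A [->|[k [v ->]]] <-].
  by rewrite setTI preimage_set0.
by rewrite setTI; exact: mF.
Qed.

Lemma measurable_translate (n : int) :
  measurable_fun setT (translate n : adic -> adic).
Proof.
apply: measurable_fun_adic => k v.
under eq_set do rewrite residue_translate.
exact: (measurable_residue k [set u | ((u + n) %% 2 ^+ k)%Z = v]).
Qed.

Section haar.
Variable R : realType.

Definition unit_lebesgue : set (measurableTypeR R) -> \bar R :=
  mrestr lebesgue_measure (measurable_itv `[0%R, 1%R[).

HB.instance Definition _ := Measure.on unit_lebesgue.

Lemma unit_lebesgue_setT : unit_lebesgue setT = 1%E.
Proof.
rewrite /unit_lebesgue /mrestr setTI lebesgue_measure_itv /= lte_fin ltr01.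
by rewrite oppr0 adde0.
Qed.

HB.instance Definition _ :=
  Measure_isProbability.Build _ _ _ unit_lebesgue unit_lebesgue_setT.

(** Its iterates on [0, 1[ are the fractional parts of 2 ^ k * x, whose first
binary digits are the successive digits of x. *)
Definition doubling (x : R) : R := 2 * x - (if 2^-1 <= x then 1 else 0).

Definition binary : measurableTypeR R -> adic :=
  fun x k => (2^-1 <= iter k doubling x :> R).

Lemma measurable_binary : measurable_fun setT binary.
Proof.
have half : measurable_fun setT (fun x : R => 2^-1 <= x).
  exact: measurable_fun_ler.
have mdouble : measurable_fun setT (doubling : _ -> R).
  apply: measurable_funB; first exact: measurable_funM.
  exact: measurable_fun_ifT.
have miter k : measurable_fun setT (fun x : R => iter k doubling x : R).
  by elim: k => [|k IH] //=; exact: measurableT_comp.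
have mdigit k b : measurable [set x | binary x k = b].
  have := measurableT_comp half (miter k) measurableT (I : measurable [set b]).
  by rewrite setTI.
apply: measurable_fun_adic; elim=> [|k IH] v.
  by rewrite /=; have [<-|v0] := eqVneq 0 v;
    [rewrite (_ : [set _ | _] = setT)|rewrite (_ : [set _ | _] = set0)] => //;
    apply/seteqP; split => // x; move/eqP: v0.
rewrite (_ : [set _ | _] =
    ([set x | residue k (binary x) = v] `&` [set x | binary x k = false]) `|`
    ([set x | residue k (binary x) = v - 2 ^+ k] `&`
     [set x | binary x k = true])).
  by apply: measurableU; exact: measurableI.
apply/seteqP; split=> x /=.
  by case: (binary x k) => /=; [right|left]; lia.
by case=> -[+ ->] /=; lia.
Qed.

HB.instance Definition _ :=
  @isMeasurableFun.Build _ _ (measurableTypeR R) adic binary measurable_binary.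

(** The digits of a uniform point are independent fair bits. Taking its most
significant digit as the least significant one of a dyadic integer therefore
makes all residues modulo 2 ^ k equally likely. *)
Definition haar : probability adic R :=
  distribution (unit_lebesgue : probability (measurableTypeR R) R)
    (binary : {mfun measurableTypeR R >-> adic}).

(** The first k binary digits of x determine the dyadic interval of length
2 ^ - k that contains x. Since [residue] reads the digits backwards, u is the
bit reversal of v; only its existence matters. The last clause, which locates
the k-th iterate of the doubling map, is what makes the induction go
through. *)
Lemma binary_interval (k : nat) (v : int) : 0 <= v < 2 ^+ k ->
  exists2 u : int, 0 <= u < 2 ^+ k & forall x : R, 0 <= x < 1 ->
    (residue k (binary x) = v <-> u%:~R <= 2 ^+ k * x < u%:~R + 1) /\
    (residue k (binary x) = v -> iter k doubling x = 2 ^+ k * x - u%:~R).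
Proof.
elim: k v => [|k IH] v vk.
  exists 0 => // x x01; rewrite /= expr0 mul1r subr0 add0r x01.
  by split=> //; split=> // _; lia.
have [p p0 pE] : exists2 p : int, 0 < p & 2 ^+ k = p by exists (2 ^+ k).
rewrite exprS pE in vk *; set b := p <= v.
have [|u0 u0p IHu] := IH (v - b%:Z * p).
  by rewrite pE /b; case: leP => /=; lia.
exists (2 * u0 + b%:Z); first by rewrite pE in u0p; case: (b) => /=; lia.
move=> x x01; have [IHu1 IHu2] := IHu x x01.
have resE : residue k.+1 (binary x) = v <->
    residue k (binary x) = v - b%:Z * p /\ binary x k = b.
  rewrite /= pE; have := residue_bounds k (binary x); rewrite pE /b.
  by case: (binary x k) => /=; case: leP => /=; split; try (move=> -[]); lia.
have uE : (2 * u0 + b%:Z)%:~R = 2 * u0%:~R + (if b then 1 else 0) :> R.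
  by rewrite rmorphD rmorphM /=; case: (b).
have digitE : residue k (binary x) = v - b%:Z * p ->
    binary x k = (2^-1 <= 2 ^+ k * x - u0%:~R).
  by move=> /IHu2 <-.
rewrite uE exprS -mulrA; split.
  rewrite resE; split=> [[rk dk]|].
    have /IHu1 := rk; rewrite digitE// in dk; rewrite -dk.
    by move=> ux; case: (leP 2^-1); move: ux; lra.
  move=> ux; have rk : residue k (binary x) = v - b%:Z * p.
    by apply/IHu1; move: ux; case: (b); lra.
  split=> //; rewrite digitE//; apply/idP/idP; move: ux; case: (b) => //=; lra.
move=> /resE[rk dk]; rewrite /= /doubling (IHu2 rk) -digitE// dk.
by case: (b); lra.
Qed.

Lemma haar_cylinder (k : nat) (v : int) : 0 <= v < 2 ^+ k ->
  haar [set s | residue k s = v] = (2 ^- k)%:E.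
Proof.
move=> /binary_interval[u uk xP].
have p0 : 0 < 2 ^+ k :> R by rewrite exprn_gt0.
rewrite /haar /distribution /pushforward /= /unit_lebesgue /mrestr.
rewrite (_ : _ `&` _ = `[u%:~R / 2 ^+ k, (u%:~R + 1) / 2 ^+ k[%classic).
  rewrite lebesgue_measure_itv /= lte_fin ltr_pM2r ?invr_gt0//.
  by rewrite ltrDl ltr01 -EFinB -mulrBl addrAC subrr add0r mul1r.
apply/seteqP; split=> x /=; rewrite !in_itv /=.
  move=> [xv x01]; have [[/(_ xv) + _] _] := xP x x01.
  by rewrite ler_pdivrMr// ltr_pdivlMr// mulrC.
rewrite ler_pdivrMr// ltr_pdivlMr// mulrC => ux.
suff x01 : 0 <= x < 1 by split=> //; apply/(xP x x01).1.
have /andP[u0 u1] := uk.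
have u0R : 0 <= u%:~R :> R by rewrite ler0z.
have u1R : u%:~R + 1 <= 2 ^+ k :> R.
  by have : u + 1 <= 2 ^+ k by [lia|]; rewrite -(ler_int R) rmorphD rmorphXn.
have /andP[ux1 ux2] := ux.
rewrite -(pmulr_rge0 _ p0) (le_trans u0R ux1) /=.
by rewrite -(ltr_pM2l p0) mulr1 (lt_le_trans ux2).
Qed.

End haar.

Lemma cylinder_empty (k : nat) (v : int) : ~~ (0 <= v < 2 ^+ k) ->
  [set s | residue k s = v] = set0.
Proof.
move=> vk; apply/seteqP; split=> s //= sv.
by move: vk; rewrite -sv residue_bounds.
Qed.

Lemma translate_cylinder (n : int) (k : nat) (v : int) : 0 <= v < 2 ^+ k ->
  translate n @^-1` [set s | residue k s = v] =
  [set s | residue k s = ((v - n) %% 2 ^+ k)%Z].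
Proof.
move=> vk; apply/seteqP; split=> s /=; rewrite residue_translate.
  by move=> <-; rewrite modzDml addrK modz_small ?residue_bounds.
by move=> ->; rewrite modzDml subrK modz_small.
Qed.

Definition translation (n : int) : {mfun adic >-> adic} :=
  mfun_Sub (mem_set (measurable_translate n)).

Section haar_uniqueness.
Variable R : realType.
Local Notation P := (haar R).

(** Dynkin's uniqueness theorem for the cylinders; it is applied below to
translation invariance, and to the independence of an invariant set from every
measurable set. *)
Lemma adic_measure_unique (m1 m2 : {measure set adic -> \bar R}) :
  (m1 setT < +oo)%E ->
  (forall k v, 0 <= v < 2 ^+ k ->
    m1 [set s | residue k s = v] = m2 [set s | residue k s = v]) ->
  forall A, measurable A -> m1 A = m2 A.
Proof.
move=> m1T m12 A mA.
have resT : [set: adic] = [set s | residue 0 s = 0] by apply/seteqP; split.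
apply: (@g_sigma_algebra_measure_unique _ R adic cylinders _
  (fun=> setT)) => //.
- by move=> B cB; exact: sub_sigma_algebra.
- by move=> _; right; exists 0%N, 0.
- by rewrite bigcup_const//; exists 0%N.
- exact: cylinders_setI.
- move=> _ [->|[k [v ->]]]; first by rewrite !measure0.
  have [/m12//|/cylinder_empty ->] := boolP (0 <= v < 2 ^+ k).
  by rewrite !measure0.
Qed.

Lemma haar_translate (n : int) (A : set adic) : measurable A ->
  P (translate n @^-1` A) = P A.
Proof.
move=> mA; pose shifted := distribution P (translation n).
rewrite -[LHS]/(shifted A); apply: (@adic_measure_unique shifted P) => //.
  exact: le_lt_trans (probability_le1 shifted measurableT) (ltry 1).
move=> k v vk; rewrite -[LHS]/(P (translate n @^-1` _)) translate_cylinder//.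
have vn : 0 <= ((v - n) %% 2 ^+ k)%Z < 2 ^+ k.
  by rewrite modz_ge0 ?ltz_pmod ?pow2_gt0 ?gt_eqF ?pow2_gt0.
exact: etrans (haar_cylinder R vn) (esym (haar_cylinder R vk)).
Qed.

Lemma invariant_translate (B : set adic) (n : nat) :
  translate 1 @^-1` B = B -> translate n%:Z @^-1` B = B.
Proof.
move=> inv; elim: n => [|n IH].
  by apply/seteqP; split=> s /=; rewrite translate0.
rewrite -[RHS]inv -[in RHS]IH; apply/seteqP.
by split=> s /=; rewrite translateD -addn1 PoszD addrC.
Qed.

(** Translations permute the residue classes modulo 2 ^ k transitively, so an
invariant set has the same mass in all of them. The value of this mass follows
by induction on k, since each class splits into two at the next level. *)
Lemma invariant_cylinder (B : set adic) (k : nat) (v : int) :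
  measurable B -> translate 1 @^-1` B = B -> 0 <= v < 2 ^+ k ->
  P (B `&` [set s | residue k s = v]) = (fine (P B) * 2 ^- k)%:E.
Proof.
move=> mB inv.
have mI l w : measurable (B `&` [set s | residue l s = w]).
  by apply: measurableI => //; exact: measurable_cylinder.
have same l (w : int) : 0 <= w < 2 ^+ l ->
    P (B `&` [set s | residue l s = w]) = P (B `&` [set s | residue l s = 0]).
  move=> wl; rewrite -(haar_translate w) ?mI// preimage_setI.
  rewrite translate_cylinder// subrr mod0z; have /andP[w0 _] := wl.
  by rewrite -(gez0_abs w0) invariant_translate.
elim: k v => [|k IH] v vk.
  rewrite expr0 invr1 mulr1 fineK ?fin_num_measure//; congr (P _).
  rewrite expr0 in vk.
  by apply/seteqP; split=> s /= => [[]//|Bs]; split=> //; lia.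
have p0 := pow2_gt0 k.
have z0 : 0 <= (0 : int) < 2 ^+ k by rewrite lexx.
have halves : B `&` [set s | residue k s = 0] =
    (B `&` [set s | residue k.+1 s = 0]) `|`
    (B `&` [set s | residue k.+1 s = 2 ^+ k]).
  rewrite -setIUr; congr (_ `&` _); apply/seteqP; split=> s /=;
    have := residue_bounds k s; case: (s k) => /=; lia.
have disj : (B `&` [set s | residue k.+1 s = 0]) `&`
    (B `&` [set s | residue k.+1 s = 2 ^+ k]) = set0.
  by apply/seteqP; split=> s //= [[_ s0] [_ s1]]; lia.
have sumE : P (B `&` [set s | residue k s = 0]) =
    (P (B `&` [set s | residue k.+1 s = 0%R]) +
     P (B `&` [set s | residue k.+1 s = (2 ^+ k)%R]))%E.
  by rewrite halves; exact: measureU.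
rewrite IH// (same k.+1 (2 ^+ k)) in sumE; last by rewrite exprS; lia.
rewrite same//; have := fin_num_measure P _ (mI k.+1 0).
move: sumE; move: (P (_ `&` _)) => [x| |]// + _.
by rewrite -EFinD => -[E]; congr EFin; rewrite exprS invfM; lra.
Qed.

(** The previous lemma says that B is independent of every cylinder. By
uniqueness of measures B is independent of itself, so P B = P B * P B. *)
Lemma adic_ergodic (B : set adic) :
  measurable B -> translate 1 @^-1` B = B -> P B = 0%E \/ P B = 1%E.
Proof.
move=> mB inv; have finB : P B \is a fin_num by exact: fin_num_measure.
have b0 : 0 <= fine (P B) by rewrite fine_ge0.
have PBB : mrestr P mB B = mscale (NngNum b0) P B.
  apply: adic_measure_unique => //.
    have mTB := measurableI _ _ measurableT mB.
    exact: le_lt_trans (probability_le1 P mTB) (ltry 1).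
  move=> k v vk; rewrite -[LHS]/(P (_ `&` B)) setIC invariant_cylinder//.
  by rewrite EFinM; congr *%E; exact/esym/haar_cylinder.
have : P (B `&` B) = ((fine (P B))%:E * P B)%E by exact: PBB.
rewrite setIid -(fineK finB) /= => -[] /eqP.
rewrite eq_sym -subr_eq0 -[X in _ - X]mulr1 -mulrBr mulf_eq0.
by rewrite subr_eq0 => /orP[]/eqP ->; [left|right].
Qed.

End haar_uniqueness.

(** * General facts on processes and classifications *)

Lemma eq_blockP (x y : biseq) (m : int) (n : nat) :
  block x m n = block y m n <->
  forall i, (i < n)%N -> x (m + i%:Z) = y (m + i%:Z).
Proof.
split=> [xy i ni|xy].
  by have := congr1 (fun w => tnth w (Ordinal ni)) xy; rewrite !tnth_mktuple.
by apply: eq_from_tnth => i; rewrite !tnth_mktuple; exact: xy.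
Qed.

Section processes.
Variable R : realType.
Implicit Type X : process R.

Lemma measurable_var X (n : int) (b : bool) :
  measurable [set t | proc_var X n t = b].
Proof.
have mX : measurable_fun setT (proc_var X n) by exact: measurable_funPT.
by have := mX measurableT [set b] I; rewrite setTI.
Qed.

Lemma measurable_block X (m : int) (n : nat) (W : set (n.-tuple bool)) :
  measurable [set t : proc_space X | W (block (sample_path t) m n)].
Proof.
rewrite (_ : [set t | _] = \bigcup_(w in W)
    [set t : proc_space X | block (sample_path t) m n = w]); last first.
  apply/seteqP; split=> [t Wt|t [w Ww /= ->]//].
  by exists (block (sample_path t) m n).
apply: fin_bigcup_measurable; first exact: finite_finset.
move=> w _.
rewrite (_ : [set t | _] = \bigcap_(i in [set: 'I_n])
    [set t : proc_space X | proc_var X (m + (i : nat)%:Z) t = tnth w i]).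
  by apply: fin_bigcap_measurable; [exact: finite_finset|
    move=> i _; exact: measurable_var].
apply/seteqP; split=> t /=; first by move=> <- i _ /=; rewrite tnth_mktuple.
by move=> wt; apply: eq_from_tnth => i; rewrite tnth_mktuple; exact: wt.
Qed.

Lemma measurable_verdict (g : classifier) X (n : nat) (a : answer) :
  measurable [set t : proc_space X | verdict g n t = a].
Proof. exact: (@measurable_block X 1 n [set w | g n w = a]). Qed.

(** The events that all V n with n >= N hold increase to an event of full
measure, and the N-th of them is contained in V N. *)
Lemma ae_eventually_cvg (d : measure_display) (T : measurableType d)
    (P : probability T R) (V : nat -> set T) :
  (forall n, measurable (V n)) ->
  {ae P, forall t, \forall n \near \oo, V n t} -> P (V n) @[n --> \oo] --> 1%E.
Proof.
move=> mV aeV.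
pose tail N := \bigcap_(n >= N) V n.
have mtail N : measurable (tail N) by exact: bigcap_measurableType.
have mU : measurable (\bigcup_N tail N) by exact: bigcup_measurable.
have PU : P (\bigcup_N tail N) = 1%E.
  have : P (~` \bigcup_N tail N) = 0%E.
    apply/(negligibleP P (measurableC mU)).
    apply: negligibleS aeV => t /= tU Vt; apply: tU.
    by have [N _ tN] := Vt; exists N.
  have := probability_setC P (measurableC mU); rewrite setCK => PC U0.
  exact: etrans PC (etrans (congr1 (fun z => 1 - z)%E U0) (sube0 _)).
have cvg1 : P (tail N) @[N --> \oo] --> 1%E.
  rewrite -PU; apply: nondecreasing_cvg_mu => // m n mn; apply/subsetPset.
  by move=> t mt k /= nk; apply: mt; exact: leq_trans nk.
apply: (@squeeze_cvge _ _ _ _ (fun N => P (tail N)) _ (fun=> 1%E)) => //;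
  last exact: cvg_cst.
near=> n; apply/andP; split; last exact: probability_le1.
by apply: le_measure; rewrite ?inE// => t /(_ n (leqnn n)).
Unshelve. all: by end_near. Qed.

Lemma pointwise_in_probability (G : process R -> Prop) (g : classifier) :
  classification_pointwise G g -> classification_in_probability G g.
Proof.
by move=> [yes no]; split=> [X GX|X sX eX nGX];
  apply: ae_eventually_cvg => [n|]; do ?[exact: measurable_verdict];
  [exact: yes|exact: no].
Qed.

(** The last q symbols contain X_(-q) = X_0, so every conditional probability
that extends them is 0 or 1, and is 1 as soon as it is positive. *)
Lemma periodic_finitarily_markovian X (q : nat) : (0 < q)%N ->
  (forall t, proc_var X 0 t = proc_var X (- q%:Z) t) ->
  finitarily_markovian X.
Proof.
move=> q0 per; apply: aeW => t; exists q; rewrite /memory_length /=.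
set one := [set _ | _ = true]; set recent := [set _ | _ = _] => i y _.
set remote := [set _ | _ = y].
have recent0 t' : recent t' -> proc_var X 0 t' = proc_var X (- q%:Z) t.
  by move=> /eq_blockP /(_ 0%N q0); rewrite addr0 per.
have mrecent : measurable recent.
  exact: (@measurable_block X _ _ [set w | w = block _ (- q%:Z) q]).
have mremote : measurable (remote `&` recent).
  by apply: measurableI => //; exact: (@measurable_block X _ _ [set w | w = y]).
case b: (proc_var X (- q%:Z) t); last first.
  rewrite /cond_prob (_ : one `&` (remote `&` recent) = set0).
    by rewrite measure0 mul0r ltxx.
  by apply/seteqP; split=> // t' [/= o [_ /recent0]]; rewrite b o.
have oneE : one `&` recent = recent.
  by apply/setIidPr => t' /recent0; rewrite b.
rewrite /cond_prob setIA (setIC one) -setIA oneE.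
set p := fine _; set r := fine (_ recent).
have [->|p0 _] := eqVneq p 0; first by rewrite mul0r ltxx.
have pr : p <= r.
  apply: fine_le; rewrite ?fin_num_measure//.
  by apply: le_measure; rewrite ?inE.
have p_ge0 : 0 <= p by rewrite fine_ge0.
rewrite !divff//; apply: contraNneq p0 => r0.
by rewrite eq_le p_ge0 andbT -r0.
Qed.

End processes.

(** * Processes over the dyadic integers *)

Section adic_processes.
Variable R : realType.

Definition adic_process (f : {mfun adic >-> bool}) : process R :=
  @Process R _ adic (haar R)
    (fun n => [the {mfun adic >-> bool} of f \o translation n]).

Variable f : {mfun adic >-> bool}.
Local Notation X := (adic_process f).

Lemma adic_path (s : adic) (n : int) :
  @sample_path R X s n = f (translate n s).
Proof. by []. Qed.

Lemma adic_path_translate (s : adic) (m n : int) :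
  @sample_path R X (translate m s) n = @sample_path R X s (m + n).
Proof. by rewrite !adic_path translateD. Qed.

Lemma adic_stationary : stationary X.
Proof.
move=> m n w; have shiftE s : block (sample_path (X := X) s) (m + 1) n =
    block (sample_path (X := X) (translate 1 s)) m n.
  apply: eq_from_tnth => i; rewrite !tnth_mktuple adic_path_translate.
  by congr (_ s _); rewrite addrA [1 + m]addrC.
under eq_set do rewrite shiftE.
apply: (haar_translate R 1).
exact: (@measurable_block R X m n [set v | v = w]).
Qed.

Lemma adic_process_ergodic : ergodic X.
Proof.
move=> A mA inv; apply: adic_ergodic; last first.
  rewrite -[in RHS]inv; apply/seteqP.
  by split=> s /=; (have -> : sample_path (X := X) (translate 1 s) =
    biseq_shift (sample_path (X := X) s) by
    apply/funext => n; rewrite adic_path_translate addrC).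
have mpath : measurable_fun setT (@sample_path R X : adic ->
    g_sigma_algebraType
      [set A | exists (n : int) (b : bool), A = [set x : biseq | x n = b]]).
  apply: (@measurability _ _ adic (g_sigma_algebraType _) setT _ _ erefl).
  move=> _ [_ [n [b ->]] <-]; rewrite setTI.
  exact: (@measurable_var R X n b).
by rewrite -[X in measurable X]setTI; exact: mpath.
Qed.

End adic_processes.

Lemma measurable_membership (A : set adic) : measurable A ->
  measurable_fun setT (fun s : adic => `[< A s >]).
Proof.
move=> mA; apply: (measurable_fun_bool true); rewrite setTI.
by rewrite (_ : _ @^-1` _ = A)//; apply/seteqP; split=> s /asboolP.
Qed.

Definition membership (A : set adic) (mA : measurable A) :
    {mfun adic >-> bool} :=
  mfun_Sub (mem_set (measurable_membership mA)).

Lemma membershipE (A : set adic) (mA : measurable A) (s : adic) :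
  membership mA s = `[< A s >].
Proof. by []. Qed.

(** * The limit of the stages *)

(** The residue classes added at a stage where the process has period q = 2 ^ e.
There is one mark in each phase, since j * (2 * q + 1) + q is j modulo q.
Consecutive marks are 2 * q + 1 > q apart, so no mark of the same stage falls
on the q positions before a mark; the offset q keeps these positions
nonnegative, so that they do not wrap around the next period. *)
Definition marks (e : nat) : set int :=
  [set v | exists2 j : nat, (j < 2 ^ e)%N &
    v = j%:Z * (2 * 2 ^+ e + 1) + 2 ^+ e].

Lemma marks_bounds (e : nat) (v : int) :
  marks e v -> 2 ^+ e <= v < 2 ^+ (2 * e + 1).
Proof.
move=> [j + ->]; rewrite exprD mulnC exprM expr1 -(ltr_nat int) natrX !natz.
by move: (2 ^+ e) => q jq; apply/andP; split; nia.
Qed.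

Section probability_bounds.
Variable R : realType.

Lemma fine_prob_le_add d (T : measurableType d) (P : probability T R)
    (A B C : set T) : measurable A -> measurable B -> measurable C ->
  A `<=` B `|` C -> fine (P A) <= fine (P B) + fine (P C).
Proof.
move=> mA mB mC ABC; rewrite -fineD ?fin_num_measure//.
apply: fine_le; rewrite ?fin_numD ?fin_num_measure//.
apply: (le_trans _ (measureU2 P mB mC)).
by apply: le_measure; rewrite ?inE//; exact: measurableU.
Qed.

Lemma haar_cylinder_le (k : nat) (v : int) :
  (haar R [set s | residue k s = v] <= (2 ^- k)%:E)%E.
Proof.
have [vk|/cylinder_empty ->] := boolP (0 <= v < 2 ^+ k).
  by rewrite haar_cylinder.
by rewrite measure0 lee_fin invr_ge0 exprn_ge0.
Qed.

(** The union bound; repeated entries of S and entries outside [0, 2 ^ k[ only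
make it less sharp. *)
Lemma haar_residue_seq_le (k : nat) (S : seq int) :
  (haar R [set s | residue k s \in S] <= ((size S)%:R / 2 ^+ k)%:E)%E.
Proof.
elim: S => [|v S IH].
  by rewrite mul0r (_ : [set s | _] = set0) ?measure0//; apply/seteqP; split.
have mS : measurable ([set s | residue k s \in S] : set adic).
  exact: (measurable_residue k [set v | v \in S]).
rewrite (_ : [set s | _] = ([set s | residue k s = v] : set adic) `|`
    [set s | residue k s \in S]); last first.
  apply/seteqP; split=> s /=; rewrite inE; first by move=> /predU1P.
  by move=> /predU1P.
apply: (le_trans (measureU2 (haar R) (measurable_cylinder k v) mS)).
rewrite /= -natr1 mulrDl addrC EFinD leeD// mul1r.
exact: haar_cylinder_le.
Qed.

End probability_bounds.

Section construction.
(** 2 ^ (e k) is the period of stage k, and N k the time at which the classifier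
is consulted on it. The growth rate makes q * (2 * reach k + 1) / 2 ^ (e (k+1)),
with q = 2 ^ (e k), at most 2 ^ - (e k + k + 3): summable in k, and small
compared with 1 / q. *)
Variables (R : realType) (e N : nat -> nat).
Hypothesis eS : forall k, e k.+1 = (3 * e k + N k + k + 5)%N.

Let P := haar R.

(** A common bound for the period 2 ^ (e k) and the time N k; being a power of
2, it is easily compared with the next period. *)
Definition reach (k : nat) : nat := 2 ^ (e k + N k).

Definition hit (i : nat) : set adic :=
  [set s | marks (e i) (residue (e i.+1) s)].

Definition hit_before (k : nat) : set adic :=
  [set s | exists2 i, (i < k)%N & hit i s].

Definition hit_ever : set adic := [set s | exists i, hit i s].

Definition near_hit (i : nat) : set adic :=
  [set s | exists2 t : int, `|t| <= (reach i)%:Z & hit i (translate t s)].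

Definition near_hit_from (k : nat) : set adic := \bigcup_i near_hit (k + i).

Lemma measurable_hit i : measurable (hit i).
Proof. exact: measurable_residue. Qed.

Lemma measurable_hit_ever : measurable hit_ever.
Proof.
rewrite (_ : hit_ever = \bigcup_i hit i); last first.
  by apply/seteqP; split=> s [i]; [exists i|exists i].
by apply: bigcup_measurable => i _; exact: measurable_hit.
Qed.

Lemma marks_lt_next i v : marks (e i) v -> 0 <= v < 2 ^+ e i.+1.
Proof.
move=> /marks_bounds /andP[v0 v1].
rewrite (le_trans _ v0) ?(ltW (pow2_gt0 _))//= (lt_le_trans v1)//.
by rewrite ler_eXn2l// eS; lia.
Qed.

(** Membership in [near_hit i] depends on a residue modulo 2 ^ (e (i + 1)),
and few residues are favourable: one for each mark and each translation. *)
Lemma near_hit_residue i : exists2 S : seq int,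
  (size S <= 2 ^ (2 * e i + N i + 2))%N &
  near_hit i = [set s | residue (e i.+1) s \in S].
Proof.
(* The index a enumerates the translation amounts t = a - reach i. *)
exists [seq ((j%:Z * (2 * 2 ^+ e i + 1) + 2 ^+ e i - (a%:Z - (reach i)%:Z))
             %% 2 ^+ e i.+1)%Z
       | j <- iota 0 (2 ^ e i), a <- iota 0 (2 * reach i + 1)].
  rewrite size_allpairs !size_iota /reach.
  rewrite (_ : 2 * e i + N i + 2 = e i + ((e i + N i) + 2))%N; last by lia.
  rewrite [in leqRHS]expnD leq_pmul2l ?expn_gt0// (expnD _ _ 2).
  by have := expn_gt0 2 (e i + N i); lia.
apply/seteqP; split=> s.
  move=> [t tr [j je tj]]; apply/allpairsP.
  exists (j, `|(t + (reach i)%:Z)%R|%N); split=> /=.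
  - by rewrite mem_iota.
  - by rewrite mem_iota; lia.
  rewrite -tj residue_translate gez0_abs; last by lia.
  rewrite addrK modzDml addrK modz_small//; exact: residue_bounds.
move=> /allpairsP[[j a] /= [jin ain sE]].
rewrite !mem_iota /= in jin ain.
exists (a%:Z - (reach i)%:Z); first by lia.
rewrite /hit /= residue_translate sE modzDml subrK.
have mj : marks (e i) (j%:Z * (2 * 2 ^+ e i + 1) + 2 ^+ e i) by exists j.
by rewrite modz_small// marks_lt_next.
Qed.

Lemma measurable_near_hit i : measurable (near_hit i).
Proof.
have [S _ ->] := near_hit_residue i.
exact: (measurable_residue _ [set v | v \in S]).
Qed.

Lemma measurable_near_hit_from k : measurable (near_hit_from k).
Proof. by apply: bigcup_measurable => i _; exact: measurable_near_hit. Qed.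

Lemma le_e i k : (i <= k)%N -> (e i <= e k)%N.
Proof.
elim: k => [|k IH]; first by rewrite leqn0 => /eqP ->.
rewrite leq_eqVlt => /predU1P[->//|/IH]; rewrite eS; lia.
Qed.

Lemma le_id_e k : (k <= e k)%N.
Proof. by case: k => // k; rewrite eS; lia. Qed.

Lemma pow_le_reach k : (2 ^ e k <= reach k)%N.
Proof. by rewrite leq_exp2l// leq_addr. Qed.

Lemma reach_le_pow k : (reach k <= 2 ^ e k.+1)%N.
Proof. by rewrite leq_exp2l// eS; lia. Qed.

Lemma le_reach i k : (i <= k)%N -> (reach i <= reach k)%N.
Proof.
elim: k => [|k IH]; first by rewrite leqn0 => /eqP ->.
rewrite leq_eqVlt => /predU1P[->//|/IH]/leq_trans; apply.
exact: leq_trans (reach_le_pow k) (pow_le_reach k.+1).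
Qed.

Lemma haar_near_hit_le i : (P (near_hit i) <= (2 ^- (e i + i + 3))%:E)%E.
Proof.
have [S sS ->] := near_hit_residue i.
apply: (le_trans (haar_residue_seq_le R _ S)); rewrite lee_fin.
have -> : e i.+1 = ((2 * e i + N i + 2) + (e i + i + 3))%N by rewrite eS; lia.
rewrite exprD invfM mulrA ler_piMl ?invr_ge0 ?exprn_ge0//.
by rewrite ler_pdivrMr ?exprn_gt0// mul1r -natrX ler_nat.
Qed.

(** The bounds of [haar_near_hit_le] at least halve from one stage to the
next. *)
Lemma haar_near_hit_from_le k :
  (P (near_hit_from k) <= (2 ^- (e k + k + 2))%:E)%E.
Proof.
apply: (le_trans (generalized_Boole_inequality P _ _)) => [i||].
- exact: measurable_near_hit.
- exact: measurable_near_hit_from.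
set u : R := 2 ^- _; have u0 : 0 <= u by rewrite invr_ge0 exprn_ge0.
have geom : (\sum_(0 <= i <oo) (u / (2 ^ i.+1)%:R)%:E <= u%:E)%E.
  have := @epsilon_trick R (fun=> 0%E) u xpredT (fun=> lexx _) u0.
  under eq_eseriesr do rewrite add0e.
  by rewrite [X in (_ <= X + _)%E]eseries0// add0e.
apply: (le_trans _ geom).
apply: lee_nneseries => i _ //.
apply: (le_trans (haar_near_hit_le _)); rewrite lee_fin /u natrX -invfM -exprD.
rewrite lef_pV2 ?posrE ?exprn_gt0// ler_eXn2l ?ltr1n//.
by have := le_e (leq_addr i k); lia.
Qed.

Lemma haar_near_hit_from_le4 k : fine (P (near_hit_from k)) <= 4^-1.
Proof.
rewrite -lee_fin fineK ?fin_num_measure//;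
  last exact: measurable_near_hit_from.
apply: (le_trans (haar_near_hit_from_le k)); rewrite lee_fin.
rewrite (_ : (4 : R) = 2 ^+ 2) -?natrX//.
rewrite lef_pV2 ?posrE -?natrX ?ltr0n ?expn_gt0//.
by rewrite ler_nat leq_exp2l// leq_addl.
Qed.

Lemma hit_before_residue k (s s' : adic) :
  residue (e k) s = residue (e k) s' -> hit_before k s -> hit_before k s'.
Proof.
move=> ss' [i ik]; rewrite /hit /= => hs; exists i => //; move: hs.
by rewrite /hit /= -!(@residue_mod (e i.+1) (e k)) ?le_e// ss'.
Qed.

Lemma hit_before_translate k (t : int) (s s' : adic) :
  residue (e k) s = residue (e k) s' ->
  hit_before k (translate t s) <-> hit_before k (translate t s').
Proof.
by move=> ss'; split; apply: hit_before_residue; rewrite !residue_translate ss'.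
Qed.

Lemma hit_before_period k (s : adic) :
  hit_before k (translate (- (2 ^ e k)%N%:Z) s) <-> hit_before k s.
Proof.
have E : residue (e k) (translate (- (2 ^ e k)%N%:Z) s) = residue (e k) s.
  rewrite residue_translate -natz natrX -[- _]mulN1r addrC modzMDl.
  by rewrite modz_small ?residue_bounds.
by split; apply: hit_before_residue.
Qed.

(** Away from the marks of the stages k and later, the limit process coincides
with the periodic process of stage k on the whole window of radius
[reach k]. *)
Lemma hit_ever_near k (s : adic) (t : int) :
  ~ near_hit_from k s -> `|t| <= (reach k)%:Z ->
  hit_ever (translate t s) <-> hit_before k (translate t s).
Proof.
move=> sU tk; split=> [[i hi]|[i _ hi]]; last by exists i.
exists i => //; rewrite ltnNge; apply/negP => ki; apply: sU.
exists (i - k)%N => //; rewrite subnKC//; exists t => //.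
by apply: le_trans tk _; rewrite lez_nat le_reach.
Qed.

End construction.

Section limit_process.
Variables (R : realType) (e N : nat -> nat).
Hypothesis eS : forall k, e k.+1 = (3 * e k + N k + k + 5)%N.

Local Notation P := (haar R).
Local Notation X := (adic_process R (membership (measurable_hit_ever e))).
Local Notation U := (near_hit_from e N).
Local Notation path := (sample_path (X := X)).
Local Notation pr A := (fine (P A)).

Let one : set adic := [set s | path s 0 = true].
Let recent (s : adic) (n : nat) : set adic :=
  [set s' | block (path s') (- n%:Z) n = block (path s) (- n%:Z) n].

Lemma limit_pathP (s : adic) (n : int) :
  path s n = true <-> hit_ever e (translate n s).
Proof. by split => [/asboolP|?]; last exact/asboolP. Qed.

Lemma measurable_one : measurable one.
Proof. exact: (@measurable_var R X 0 true). Qed.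

Lemma measurable_recent s n : measurable (recent s n).
Proof. exact: (@measurable_block R X _ _ [set w | w = _]). Qed.

Lemma recentP (s s' : adic) (n : nat) :
  recent s n s' <-> forall a, (0 < a <= n)%N ->
    (hit_ever e (translate (- a%:Z) s') <-> hit_ever e (translate (- a%:Z) s)).
Proof.
rewrite /recent /= eq_blockP; split=> [same a /andP[a0 an]|same i ni].
  have := same (n - a)%N.
  rewrite (_ : - n%:Z + (n - a)%N%:Z = - a%:Z); last by lia.
  rewrite ltn_subrL a0 (leq_trans a0 an) => /(_ isT) E.
  by rewrite -!limit_pathP E.
rewrite (_ : - n%:Z + i%:Z = - (n - i)%N%:Z); last by lia.
have /same : (0 < n - i <= n)%N by lia.
by rewrite -!limit_pathP; case: (path s' _) (path s _) => -[] // [] // h1 h2;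
  [rewrite h1|rewrite h2].
Qed.

Lemma pr_U_le k : pr (U k) <= 2 ^- (e k + k + 2).
Proof.
rewrite -lee_fin fineK ?fin_num_measure//; first exact: haar_near_hit_from_le.
exact: measurable_near_hit_from.
Qed.

Lemma pr_cylinder k v :
  0 <= v < 2 ^+ k -> pr [set s | residue k s = v] = 2 ^- k.
Proof. by move=> vk; rewrite haar_cylinder. Qed.

Section typical_past.
Variable s : adic.
Hypothesis sU : ~ U 0%N s.

Lemma typical_tail k : ~ U k s.
Proof. by move=> [i _ hi]; apply: sU; exists (k + i)%N. Qed.

Lemma typical_now : ~ hit_ever e s.
Proof.
rewrite -(translate0 s) (hit_ever_near eS sU) ?normr0//.
by move=> [i].
Qed.

(** If s' avoids the later marks, then around time 0 its path has period
2 ^ (e k), so it takes the same value at times 0 and - 2 ^ (e k); the latter is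
in the block shared with s, whose path is 0 at both times. *)
Lemma one_recent_sub k : one `&` recent s (2 ^ e k) `<=` U k.
Proof.
move=> s' [/limit_pathP hs' /recentP s's]; rewrite translate0 in hs'.
apply: contrapT => s'U; apply: typical_now.
have kk : `|- (2 ^ e k)%N%:Z| <= (reach e N k)%:Z.
  by rewrite normrN lez_nat pow_le_reach.
have r0 : `|0 : int| <= (reach e N k)%:Z by [].
have h1 : hit_before e k s'.
  rewrite -(translate0 s'); apply/(hit_ever_near eS s'U r0).
  by rewrite translate0.
have h2 : hit_ever e (translate (- (2 ^ e k)%N%:Z) s').
  by apply/(hit_ever_near eS s'U kk)/(hit_before_period eS).
have h3 : hit_ever e (translate (- (2 ^ e k)%N%:Z) s).
  by apply/s's; rewrite // expn_gt0 leqnn.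
rewrite -(translate0 s); apply/(hit_ever_near eS (@typical_tail k) r0).
rewrite translate0; apply/(hit_before_period eS).
exact/(hit_ever_near eS (@typical_tail k) kk).
Qed.

Lemma cylinder_sub_recent k :
  [set s' | residue (e k) s' = residue (e k) s] `<=` recent s (2 ^ e k) `|` U k.
Proof.
move=> s' /= s's; have [|s'U] := pselect (U k s'); [by right|left].
apply/recentP => a /andP[_ ak].
have ar : `|- a%:Z| <= (reach e N k)%:Z.
  by rewrite normrN lez_nat (leq_trans ak) ?pow_le_reach.
rewrite (hit_ever_near eS s'U ar) (hit_ever_near eS (@typical_tail k) ar).
exact: (hit_before_translate eS).
Qed.

(** A point at a mark of stage k has value 1 now. If it also avoids the marks of
the stages after k, its last 2 ^ (e k) symbols come from the marks before stage
k, because no other mark of stage k is that close; they depend on the phase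
only, which is that of s. *)
Lemma mark_sub_one_recent k (v : int) :
  marks (e k) v -> (v %% 2 ^+ e k)%Z = residue (e k) s ->
  [set s' | residue (e k.+1) s' = v] `<=`
    (one `&` recent s (2 ^ e k)) `|` U k.+1.
Proof.
move=> mv vs s' /= s'v; have [|s'U] := pselect (U k.+1 s'); [by right|left].
split.
  by apply/limit_pathP; rewrite translate0; exists k; rewrite /hit /= s'v.
apply/recentP => a /andP[a0 ak].
have ar : `|- a%:Z| <= (reach e N k)%:Z.
  by rewrite normrN lez_nat (leq_trans ak) ?pow_le_reach.
have ar1 : `|- a%:Z| <= (reach e N k.+1)%:Z.
  by rewrite (le_trans ar)// lez_nat (le_reach eS).
have s's : residue (e k) s' = residue (e k) s.
  by rewrite -vs -s'v residue_mod// (le_e eS).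
rewrite (hit_ever_near eS s'U ar1) (hit_ever_near eS (@typical_tail k) ar).
rewrite -(hit_before_translate eS _ s's).
split=> [[i + hi]|[i ik hi]]; last by exists i => //; exact: ltnW.
rewrite ltnS leq_eqVlt => /predU1P[ik|ik]; last by exists i.
(* Consecutive marks are 2 * 2 ^ (e k) + 1 apart, so v - a is not a mark. *)
exfalso; move: hi; rewrite ik /hit /= residue_translate s'v.
have /andP[v0 _] := marks_bounds mv.
have /andP[_ v1] := marks_lt_next eS mv.
have aq : a%:Z <= 2 ^+ e k by rewrite -natz -(ler_nat int) natrX in ak *; lia.
rewrite modz_small; last by apply/andP; split; lia.
move: mv => [j _ ->] [j' _].
move: (2 ^+ e k) aq => q aq.
have : (j%:Z = j'%:Z) \/ (j%:Z + 1 <= j'%:Z) \/ (j'%:Z + 1 <= j%:Z) by lia.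
by case=> [|[|]]; nia.
Qed.

Lemma mark_exists k :
  exists2 v, marks (e k) v & (v %% 2 ^+ e k)%Z = residue (e k) s.
Proof.
have /andP[r0 r1] := residue_bounds (e k) s.
exists (residue (e k) s * (2 * 2 ^+ e k + 1) + 2 ^+ e k).
  exists `|residue (e k) s|%N; last by rewrite gez0_abs.
  by rewrite -ltz_nat gez0_abs// -natz natrX.
rewrite (_ : _ + _ = (2 * residue (e k) s + 1) * 2 ^+ e k + residue (e k) s);
  last by ring.
by rewrite modzMDl modz_small// r0.
Qed.

Lemma typical_cond_prob_gt0 k : 0 < cond_prob P one (recent s (2 ^ e k)).
Proof.
have [v mv vs] := mark_exists k.
have vb := marks_lt_next eS mv.
have mo := measurableI _ _ measurable_one (measurable_recent s (2 ^ e k)).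
have := fine_prob_le_add P (measurable_cylinder _ v) mo
  (measurable_near_hit_from eS k.+1) (mark_sub_one_recent mv vs).
rewrite pr_cylinder// => le1.
have p_gt0 : 0 < pr (one `&` recent s (2 ^ e k)).
  have : 2 ^- (e k.+1 + k.+1 + 2) < 2 ^- e k.+1 :> R.
    by rewrite ltf_pV2 ?posrE ?exprn_gt0// ltr_eXn2l ?ltr1n//; lia.
  by have := pr_U_le k.+1; lra.
rewrite divr_gt0// (lt_le_trans p_gt0)//.
have mr := measurable_recent s (2 ^ e k).
apply: fine_le; rewrite ?fin_num_measure//.
by apply: le_measure; rewrite ?inE.
Qed.

(** With q = 2 ^ - (e k), i = 2 ^ - k and u = q * i / 4 bounding the probability
of a later mark nearby, the ratio is at most u / (q - u) <= i. *)
Lemma typical_cond_prob_le k : cond_prob P one (recent s (2 ^ e k)) <= 2 ^- k.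
Proof.
have mo := measurableI _ _ measurable_one (measurable_recent s (2 ^ e k)).
have mU := measurable_near_hit_from eS k.
have := fine_prob_le_add P (measurable_cylinder _ _) (measurable_recent s _)
  mU (@cylinder_sub_recent k).
rewrite pr_cylinder ?residue_bounds// => le1.
have le2 : pr (one `&` recent s (2 ^ e k)) <= pr (U k).
  apply: fine_le; rewrite ?fin_num_measure//.
  by apply: le_measure; rewrite ?inE//; exact: one_recent_sub.
have le3 := pr_U_le k.
have uE : 2 ^- (e k + k + 2) = 2 ^- e k * 2 ^- k / 4 :> R.
  rewrite (exprD _ (e k + k)) (exprD _ (e k)) (_ : 2 ^+ 2 = 4 :> R) -?natrX//.
  by rewrite !natrX (invfM (_ * _)) (invfM (2 ^+ e k)).
have q0 : 0 < 2 ^- e k :> R by rewrite invr_gt0 exprn_gt0.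
have k0 : 0 < 2 ^- k :> R by rewrite invr_gt0 exprn_gt0.
have k1 : 2 ^- k <= 1 :> R by rewrite invf_le1 ?exprn_gt0// exprn_ege1// ler1n.
rewrite uE in le3; move: le1 le2 le3 q0 k0 k1; rewrite /cond_prob.
move: (2 ^- e k) (2 ^- k) (pr _) (pr (recent _ _)) (pr (U k)) => q i a b u.
move=> qbu au uq q0 i0 i1.
have qi : q * i <= q by rewrite ler_piMr// ltW.
have bq : 3 / 4 * q <= b by lra.
have ib : i * (3 / 4 * q) <= i * b by rewrite ler_wpM2l// ltW.
have qi0 : 0 < q * i by rewrite mulr_gt0.
by rewrite ler_pdivrMr; [|lra]; rewrite (mulrC i (_ * q)) in ib; lra.
Qed.

(** A memory length K forces all the conditional probabilities given more than K
past symbols of s to be equal, as they are positive; but they are at most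
2 ^ - k. *)
Lemma typical_no_memory_length K : ~ memory_length X (path s) K.
Proof.
move=> mem; pose c := cond_prob P one (recent s K).
have cE k : (K < 2 ^ e k)%N -> c = cond_prob P one (recent s (2 ^ e k)).
  move=> Kk; pose i := (2 ^ e k - K)%N.
  have i0 : (0 < i)%N by rewrite subn_gt0.
  have Ki : (K + i)%N = (2 ^ e k)%N by rewrite subnKC// ltnW.
  have := mem i (block (path s) (- (K + i)%N%:Z) i) i0.
  rewrite /= -/(recent s K) -/one (_ : _ `&` _ = recent s (2 ^ e k)).
    by apply; exact: typical_cond_prob_gt0.
  rewrite -Ki /recent; apply/seteqP; split=> s' /=.
    move=> [/eq_blockP old /eq_blockP new]; apply/eq_blockP => j jKi.
    have [/old//|ij] := ltnP j i.
    have jK : (j - i < K)%N by lia.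
    have := new _ jK.
    by rewrite (_ : - K%:Z + _ = - (K + i)%N%:Z + j%:Z)//; lia.
  move=> /eq_blockP all; split; apply/eq_blockP => j ji.
    by apply: all; rewrite (leq_trans ji)// leq_addl.
  have := all (i + j)%N; rewrite (_ : _ + _ = - K%:Z + j%:Z); last by lia.
  by apply; rewrite addnC ltn_add2r.
have K0 : (K < 2 ^ e K)%N by rewrite (leq_ltn_trans (le_id_e eS K))// ltn_expl.
have c0 : 0 < c by rewrite (cE K K0) typical_cond_prob_gt0.
pose k := maxn K (Num.bound c^-1).
have Kk : (K < 2 ^ e k)%N.
  rewrite (leq_ltn_trans (leq_maxl K (Num.bound c^-1)))//.
  by rewrite (leq_ltn_trans (le_id_e eS k))// ltn_expl.
have := typical_cond_prob_le k; rewrite -cE// leNgt => /negP; apply.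
rewrite -[ltRHS]invrK ltf_pV2 ?posrE ?invr_gt0 ?exprn_gt0//.
apply: (lt_le_trans (archi_boundP _)); first by rewrite invr_ge0 ltW.
by rewrite -natrX ler_nat (leq_trans (leq_maxr K _))// -/k ltnW// ltn_expl.
Qed.

End typical_past.
End limit_process.

Section limit_process_verdicts.
Variables (R : realType) (e N : nat -> nat).
Hypothesis eS : forall k, e k.+1 = (3 * e k + N k + k + 5)%N.
Local Notation X := (adic_process R (membership (measurable_hit_ever e))).

Lemma verdict_limit_ge (g : classifier) (k : nat) (A : set adic)
    (mA : measurable A) (a : answer) :
  (forall s, A s <-> hit_before e k s) ->
  fine (haar R [set s |
    verdict (X := adic_process R (membership mA)) g (N k) s = a]) <=
  fine (haar R [set s | verdict (X := X) g (N k) s = a]) + 4^-1.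
Proof.
move=> Ak.
have mU := measurable_near_hit_from eS k.
have mVA := @measurable_verdict R g (adic_process R (membership mA)) (N k) a.
have mVX := @measurable_verdict R g X (N k) a.
apply: (le_trans (fine_prob_le_add (haar R) mVA mVX mU _)).
  move=> s /= gs.
  have [|sU] := pselect (near_hit_from e N k s); [by right|left].
  rewrite -gs /verdict; congr (g _ _); apply/eq_blockP => i iN.
  have ir : `|1 + i%:Z| <= (reach e N k)%:Z.
    suff : (i < reach e N k)%N by lia.
    rewrite (leq_trans iN)//.
    rewrite (leq_trans (ltnW (ltn_expl (N k) (isT : 1 < 2)%N)))//.
    by rewrite leq_exp2l// leq_addl.
  rewrite !adic_path !membershipE; apply/asboolP/asboolP.
    by move=> /(hit_ever_near eS sU ir) /Ak.
  by move=> /Ak /(hit_ever_near eS sU ir).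
by rewrite lerD2l haar_near_hit_from_le4.
Qed.

(** The points covered by [typical_no_memory_length] have probability at least
3 / 4. *)
Lemma limit_not_finitarily_markovian : ~ finitarily_markovian X.
Proof.
move=> fm; have mU := measurable_near_hit_from eS 0.
have : haar R (~` near_hit_from e N 0) = 0%E.
  apply/(negligibleP (haar R) (measurableC mU)).
  apply: negligibleS fm => s sU [K]; exact: (typical_no_memory_length eS sU).
have PC := probability_setC (haar R) mU; rewrite PC.
rewrite -(fineK (fin_num_measure (haar R) _ mU)) -EFinB => -[].
by have := haar_near_hit_from_le4 R eS 0; lra.
Qed.

End limit_process_verdicts.

(** * The diagonal construction *)

Section periodic_stage.
Variable R : realType.

Definition stage_set (p : nat * set int) : set adic :=
  [set s | p.2 (residue p.1 s)].

Lemma measurable_stage_set p : measurable (stage_set p).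
Proof. exact: measurable_residue. Qed.

Definition stage_process (p : nat * set int) : process R :=
  adic_process R (membership (measurable_stage_set p)).

Lemma stage_process_class p : finitarily_markovian_class (stage_process p).
Proof.
split; [exact: adic_stationary|exact: adic_process_ergodic|].
apply: (@periodic_finitarily_markovian R _ (2 ^ p.1)).
  by rewrite expn_gt0.
move=> s; rewrite -!/(sample_path (X := stage_process p) s _) !adic_path.
rewrite !membershipE /stage_set /= !residue_translate -natz natrX addr0.
by rewrite -[- _]mulN1r [_ + -1 * _]addrC modzMDl.
Qed.

Definition refine (N k : nat) (p : nat * set int) : nat * set int :=
  ((3 * p.1 + N + k + 5)%N,
   [set v | p.2 (v %% 2 ^+ p.1)%Z \/ marks p.1 v]).

(** The time N l may depend on the whole l-th stage: it is chosen by looking at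
how the classifier behaves on the process of that stage. *)
Fixpoint stage (N : nat -> nat * set int -> nat) (k : nat) : nat * set int :=
  if k is l.+1 then refine (N l (stage N l)) l (stage N l) else (0%N, set0).

Lemma stage_hit_before (N : nat -> nat * set int -> nat) (k : nat) (s : adic) :
  stage_set (stage N k) s <-> hit_before (fun i => (stage N i).1) k s.
Proof.
rewrite /stage_set; elim: k => [|k IH] /=; first by split=> // -[].
rewrite residue_mod; last by lia.
split=> [[/IH [i ik hi]|mk]|[i + hi]].
- by exists i => //; exact: ltnW.
- by exists k.
rewrite ltnS leq_eqVlt => /predU1P[ik|ik]; first by right; move: hi; rewrite ik.
by left; apply/IH; exists i.
Qed.

End periodic_stage.

(** At time N M with M large, the limit process would receive YES with
probability at least 1 / 2, and NO with probability greater than 1 / 2. *)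
Lemma no_classification_in_probability (R : realType) (g : classifier) :
  ~ classification_in_probability (@finitarily_markovian_class R) g.
Proof.
move=> [yes no].
have late (kp : nat * (nat * set int)) : exists N, (kp.1 <= N)%N /\
    3 / 4 <= fine (haar R [set s |
      verdict (X := stage_process R kp.2) g N s = YES]).
  have cvg1 := yes _ (stage_process_class R kp.2).
  have lt1 : ((3 / 4 : R)%:E < 1)%E by rewrite lte_fin; lra.
  have [M _ Mn] := cvg1 _ (open_ereal_gt_ereal lt1).
  exists (maxn kp.1 M); split; first exact: leq_maxl.
  have := Mn _ (leq_maxr kp.1 M) => /=.
  have mV := @measurable_verdict R g (stage_process R kp.2) (maxn kp.1 M) YES.
  rewrite -[X in (_ < X)%E](fineK (fin_num_measure (haar R) _ mV)) lte_fin.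
  exact: ltW.
have [Nf NfP] := choice late.
pose Nk k p := Nf (k, p).
pose e k := (stage Nk k).1; pose N k := Nk k (stage Nk k).
have eS k : e k.+1 = (3 * e k + N k + k + 5)%N by [].
pose X := adic_process R (membership (measurable_hit_ever e)).
have nfm : ~ finitarily_markovian_class X.
  by move=> [_ _]; exact: (limit_not_finitarily_markovian eS).
have := no X (adic_stationary R _) (@adic_process_ergodic _ _) nfm => cvg1.
have lt1 : ((1 / 2 : R)%:E < 1)%E by rewrite lte_fin; lra.
have [M _ Mn] := cvg1 _ (open_ereal_gt_ereal lt1).
have [MN yesM] := NfP (M, stage Nk M).
have mY := @measurable_verdict R g X (N M) YES.
have mN := @measurable_verdict R g X (N M) NO.
have PN : 1 / 2 < fine (haar R [set s | verdict (X := X) g (N M) s = NO]).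
  have := Mn _ MN => /=.
  by rewrite -[X in (_ < X)%E](fineK (fin_num_measure (haar R) _ mN)) lte_fin.
have PY : 1 / 2 <= fine (haar R [set s | verdict (X := X) g (N M) s = YES]).
  have := verdict_limit_ge R eS g (measurable_stage_set (stage Nk M)) YES
    (@stage_hit_before Nk M).
  by move: yesM; rewrite /= -/(N M); lra.
have disj : [set s | verdict (X := X) g (N M) s = YES] `&`
    [set s | verdict (X := X) g (N M) s = NO] = set0.
  by apply/seteqP; split=> // s [/= ->].
have := probability_le1 (haar R) (measurableU _ _ mY mN).
rewrite measureU// -(fineK (fin_num_measure (haar R) _ mY)).
rewrite -(fineK (fin_num_measure (haar R) _ mN)) -EFinD lee_fin; lra.
Qed.

Theorem corollary2 (R : realType) :
  ~ (exists g : classifier,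
       classification_pointwise (@finitarily_markovian_class R) g) /\
  ~ (exists g : classifier,
       classification_in_probability (@finitarily_markovian_class R) g).
Proof.
split=> [[g /pointwise_in_probability]|[g]];
  exact: no_classification_in_probability.
Qed.
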